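(* Let $X$ be a set with $|X|\geq 2$ and let $\mathcal{B} \subset \mathrm{Br}(X)$ be a Hall set. For every $a < b \in \mathcal{B}$, $$\| [a, b] \|_{\mathcal{B}} \leq 2^{\left(n^{\frac{n(n+1)}{2}}\right)} \quad \text{where } n := |a| + |b|.$$
   Context: The base field is $\mathbb{K}=\mathbb{R}$ or $\mathbb{C}$; $X$ is a set (possibly infinite) with at least two elements. $\mathrm{Br}(X)$ is the free magma over $X$: the set of formal binary brackets (rooted planar binary trees with leaves labelled by elements of $X$), with product $(t_1,t_2)$. For $t\in \mathrm{Br}(X)$, $|t|$ is its number of leaves; if $t\notin X$, $t$ is written uniquely as $t=(\lambda(t),\mu(t))$. $\mathcal{L}(X)$ is the free Lie algebra over $X$ and $\mathrm{ev}:\mathrm{Br}(X)\to\mathcal{L}(X)$ is the canonical evaluation ($\mathrm{ev}(x)=x$ for $x\in X$, $\mathrm{ev}((t_1,t_2))=[\mathrm{ev}(t_1),\mathrm{ev}(t_2)]$). For $a,b\in\mathrm{Br}(X)$, $[a,b]$ denotes $[\mathrm{ev}(a),\mathrm{ev}(b)]\in\mathcal{L}(X)$. A Hall set is a subset $\mathcal{B}\subset\mathrm{Br}(X)$ endowed with a total order $<$ such that: (i) $X\subset\mathcal{B}$; (ii) for all $b_1,b_2\in\mathrm{Br}(X)$, $(b_1,b_2)\in\mathcal{B}$ iff $b_1,b_2\in\mathcal{B}$, $b_1<b_2$ and either $b_2\in X$ or $\lambda(b_2)\leq b_1$; (iii) for all $b_1,b_2\in\mathcal{B}$ with $(b_1,b_2)\in\mathcal{B}$,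 $b_1<(b_1,b_2)$. By a theorem of Viennot, $\mathrm{ev}$ is injective on $\mathcal{B}$ and $\mathrm{ev}(\mathcal{B})$ is a basis of $\mathcal{L}(X)$. For $u=\sum_{c\in\mathcal{B}}\alpha_c\,\mathrm{ev}(c)\in\mathcal{L}(X)$ (finite sum), $\|u\|_{\mathcal{B}}:=\sum_{c}|\alpha_c|$. *)

(* Defs.v *)
From HB Require Import structures.
From mathcomp Require Import all_boot all_order all_algebra finmap.
From mathcomp Require Import boolp classical_sets reals.
From mathcomp Require Import complex.

Set Implicit Arguments.
Unset Strict Implicit.
Unset Printing Implicit Defensive.

Import Order.TTheory GRing.Theory Num.Theory.

Local Open Scope ring_scope.

Inductive real_or_complex : numFieldType -> Prop :=
| RealScalars (R : realType) : real_or_complex R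
| ComplexScalars (R : realType) : real_or_complex (complex R).

Inductive Br (X : Type) : Type :=
| Leaf (x : X)
| Node (t1 t2 : Br X).

HB.instance Definition _ (X : Type) := gen_eqMixin (Br X).
HB.instance Definition _ (X : Type) := gen_choiceMixin (Br X).

Fixpoint leaves (X : Type) (t : Br X) : nat :=
  match t with
  | Leaf _ => 1
  | Node t1 t2 => leaves t1 + leaves t2
  end.

HB.mixin Record Lmodule_isLieAlgebra (K : fieldType) L of GRing.Lmodule K L := {
  lie : L -> L -> L;
  lie_linearl : forall v, linear (fun u => lie u v);
  lie_linearr : forall u, linear (lie u);
  lie_alternating : forall u, lie u u = 0;
  lie_jacobi : forall u v w,
    lie u (lie v w) + lie v (lie w u) + lie w (lie u v) = 0
}.

#[short(type="lieAlgType")]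
HB.structure Definition LieAlgebra (K : fieldType) :=
  {L of GRing.Lmodule K L & Lmodule_isLieAlgebra K L}.

Definition lie_morphism (K : fieldType) (L M : lieAlgType K) (phi : L -> M) :
    Prop :=
  linear phi /\ {morph phi : u v / lie u v}.

Definition is_free_lie (K : fieldType) (X : Type) (L : lieAlgType K)
    (iota : X -> L) : Prop :=
  forall (M : lieAlgType K) (f : X -> M),
    exists! phi : L -> M, lie_morphism phi /\ forall x, phi (iota x) = f x.

Fixpoint ev (K : fieldType) (X : Type) (L : lieAlgType K) (iota : X -> L)
    (t : Br X) : L :=
  match t with
  | Leaf x => iota x
  | Node t1 t2 => lie (ev iota t1) (ev iota t2)
  end.

(* Only the restriction of le to B matters; it is the reflexive (<=) version of
   the order on B, and reflexivity is contained in totality. *)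
Record is_hall_set (X : Type) (B : set (Br X)) (le : rel (Br X)) : Prop :=
  IsHallSet {
    hall_le_anti : {in B &, antisymmetric le};
    hall_le_trans : {in B & &, transitive le};
    hall_le_total : {in B &, total le};
    hall_leaf : forall x, Leaf x \in B;
    hall_node : forall b1 b2, Node b1 b2 \in B <->
      [/\ b1 \in B, b2 \in B, b1 != b2 /\ le b1 b2 &
          match b2 with Leaf _ => True | Node l _ => le l b1 end];
    hall_lt_node : forall b1 b2, b1 \in B -> b2 \in B -> Node b1 b2 \in B ->
      b1 != Node b1 b2 /\ le b1 (Node b1 b2)
  }.

Section HallNorm.
Variables (K : numFieldType) (X : Type) (L : lieAlgType K) (iota : X -> L).
Variable B : set (Br X).

Definition is_hall_decomp (u : L) (alpha : {fsfun Br X -> K with 0}) : Prop :=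
  {subset finsupp alpha <= B} /\
  u = \sum_(c <- finsupp alpha) alpha c *: ev iota c.

(* For a Hall set B of a free Lie algebra, Viennot's theorem says that every u
   has exactly one decomposition, so neither the choice made by xget nor its
   default value matters. *)
Definition hall_coord (u : L) : {fsfun Br X -> K with 0} :=
  xget [fsfun] (is_hall_decomp u).

Definition hall_norm (u : L) : K :=
  \sum_(c <- finsupp (hall_coord u)) `|hall_coord u c|.

End HallNorm.

(* Main.v *)
(* Existence of a short decomposition.  If a < b and (a, b) is not in the Hall
   set, then b = (b1, b2) with a < b1 < b2 and
   [a, b] = [[a, b1], b2] + [b1, [a, b2]].  Expanding the inner brackets, of
   smaller degree, leaves brackets of total degree n of two Hall trees that are
   both > a.  So the smaller argument strictly increases while its letters stay
   among the at most n letters of a and b and its degree stays < n.  A Hall tree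
   is determined by its foliage, so this happens at most n^n times, each time
   at the cost of a factor 2 F where F bounds the norms in degree < n.

   Uniqueness of the decomposition (without which hall_norm would depend on a
   choice) and injectivity of the foliage both come from Lazard elimination
   along a finite subtree-closed piece h1 < h2 < ... of the Hall set.  For
   independence, given a Lie algebra M in which the trees after h are
   independent, M is replaced by the semidirect product of K d/dt with the
   divided power series over M: h is sent to d/dt and c <> h to the series
   whose n-th coefficient is the image of ad_h^n c. *)
From HB Require Import structures.
Require Import Defs.
From mathcomp Require Import all_boot all_order all_algebra finmap.
From mathcomp Require Import boolp classical_sets functions reals.

Set Implicit Arguments.
Unset Strict Implicit.
Unset Printing Implicit Defensive.

Import Order.TTheory GRing.Theory Num.Theory.

Local Open Scope ring_scope.

(** * Bracket identities in a Lie algebra *)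

Section LieTheory.
Variables (K : fieldType) (L : lieAlgType K).
Implicit Types (u v w : L) (k : K).

Lemma lieDl u v w : lie (u + v) w = lie u w + lie v w.
Proof. by have := lie_linearl w 1 u v; rewrite !scale1r. Qed.

Lemma lieDr u v w : lie w (u + v) = lie w u + lie w v.
Proof. by have := lie_linearr w 1 u v; rewrite !scale1r. Qed.

Lemma lie0l u : lie 0 u = 0.
Proof. by apply: (addrI (lie 0 u)); rewrite -lieDl !addr0. Qed.

Lemma lie0r u : lie u 0 = 0.
Proof. by apply: (addrI (lie u 0)); rewrite -lieDr !addr0. Qed.

Lemma lieZr k u v : lie u (k *: v) = k *: lie u v.
Proof. by have := lie_linearr u k v 0; rewrite lie0r !addr0. Qed.

Lemma lieNr u v : lie u (- v) = - lie u v.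
Proof. by rewrite -scaleN1r lieZr scaleN1r. Qed.

Lemma lie_anti u v : lie u v = - lie v u.
Proof.
apply/eqP; rewrite -addr_eq0; apply/eqP.
by have := lie_alternating (u + v); rewrite lieDl !lieDr !lie_alternating add0r addr0.
Qed.

Lemma lie_leibniz u v w : lie u (lie v w) = lie (lie u v) w + lie v (lie u w).
Proof.
have /eqP := lie_jacobi u v w; rewrite -addrA addr_eq0 => /eqP ->.
by rewrite (lie_anti w u) (lie_anti w (lie u v)) lieNr opprD !opprK addrC.
Qed.

End LieTheory.

(* [divseq M] is M tensored with divided power series in one variable t: the
   sequence u stands for the sum of the u n t^n/n!, so that the shift is d/dt. *)
Definition divseq (K : fieldType) (M : lieAlgType K) := nat -> M.

(** * Divided power series over a Lie algebra, extended by d/dt *)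

Section DividedPowerSeries.
Variables (K : fieldType) (M : lieAlgType K).

HB.instance Definition _ := GRing.Lmodule.on (divseq M).

Implicit Types u v w : divseq M.

Definition shift u : divseq M := fun n => u n.+1.

(** The recursion is the Leibniz rule for d/dt: it gives the n-th derivative at 0 of the bracket of
    two series without binomial coefficients. *)
Fixpoint divlie_coef n u v : M :=
  if n is n'.+1 then divlie_coef n' (shift u) v + divlie_coef n' u (shift v)
  else lie (u 0%N) (v 0%N).

Definition divlie u v : divseq M := fun n => divlie_coef n u v.

Lemma shift_linear k u v : shift (k *: u + v) = k *: shift u + shift v.
Proof. by []. Qed.

Lemma shift_divlie u v :
  shift (divlie u v) = divlie (shift u) v + divlie u (shift v).
Proof. by []. Qed.

Lemma divlie_coef_linearl n k u v w :
  divlie_coef n (k *: u + v) w = k *: divlie_coef n u w + divlie_coef n v w.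
Proof.
elim: n u v w => [|n IHn] u v w /=; first exact: lie_linearl.
by rewrite shift_linear !IHn scalerDr addrACA.
Qed.

Lemma divlie_coef_linearr n k u v w :
  divlie_coef n w (k *: u + v) = k *: divlie_coef n w u + divlie_coef n w v.
Proof.
elim: n u v w => [|n IHn] u v w /=; first exact: lie_linearr.
by rewrite shift_linear !IHn scalerDr addrACA.
Qed.

Lemma divlie_coefDr n u v w :
  divlie_coef n w (u + v) = divlie_coef n w u + divlie_coef n w v.
Proof. by have := divlie_coef_linearr n 1 u v w; rewrite !scale1r. Qed.

Lemma divlie_coef_anti n u v : divlie_coef n u v = - divlie_coef n v u.
Proof.
elim: n u v => [|n IHn] u v /=; first exact: lie_anti.
by rewrite opprD -!IHn addrC.
Qed.

Lemma divlie_linearl w : linear (fun u => divlie u w).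
Proof. by move=> k u v; apply/funext => n; apply: divlie_coef_linearl. Qed.

Lemma divlie_linearr w : linear (divlie w).
Proof. by move=> k u v; apply/funext => n; apply: divlie_coef_linearr. Qed.

Lemma divlie_alternating u : divlie u u = 0.
Proof.
apply/funext => -[|n]; first exact: lie_alternating.
by rewrite /divlie /= (divlie_coef_anti n u) addrN.
Qed.

Lemma divlie_jacobi u v w :
  divlie u (divlie v w) + divlie v (divlie w u) + divlie w (divlie u v) = 0.
Proof.
apply/funext => n.
change (divlie_coef n u (divlie v w) + divlie_coef n v (divlie w u)
  + divlie_coef n w (divlie u v) = 0).
elim: n u v w => [|n IHn] u v w; first exact: lie_jacobi.
rewrite /= !shift_divlie !divlie_coefDr.
set a1 := divlie_coef n (shift u) _; set a2 := divlie_coef n u _.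
set a3 := divlie_coef n u _; set b1 := divlie_coef n (shift v) _.
set b2 := divlie_coef n v _; set b3 := divlie_coef n v _.
set c1 := divlie_coef n (shift w) _; set c2 := divlie_coef n w _.
set c3 := divlie_coef n w _.
(* The nine terms form three Jacobi sums, in which [u], [v] and [w] respectively is shifted. *)
have -> : a1 + (a2 + a3) + (b1 + (b2 + b3)) + (c1 + (c2 + c3)) =
  (a1 + b3 + c2) + (a2 + b1 + c3) + (a3 + b2 + c1).
  by rewrite !addrA (ACl (1*6*8*2*4*9*3*5*7)).
by rewrite [X in X + _ + _]IHn [X in _ + X + _]IHn [X in _ + X]IHn !addr0.
Qed.

HB.instance Definition _ := Lmodule_isLieAlgebra.Build K (divseq M)
  divlie_linearl divlie_linearr divlie_alternating divlie_jacobi.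

(* The semidirect product of the line spanned by d/dt with [divseq M]. *)
Definition elim_lie := (K^o * divseq M)%type.

HB.instance Definition _ := GRing.Lmodule.on elim_lie.

(** A pair (k, u) stands for k d/dt + u, and the bracket of d/dt with a series is its derivative. *)
Definition elim_bracket (p q : elim_lie) : elim_lie :=
  (0, p.1 *: shift q.2 - q.1 *: shift p.2 + lie p.2 q.2).

Lemma elim_alternating p : elim_bracket p p = 0.
Proof. by rewrite /elim_bracket subrr add0r lie_alternating. Qed.

Lemma elim_anti p q : elim_bracket p q = - elim_bracket q p.
Proof.
congr (_, _); first by rewrite /= oppr0.
by rewrite /= opprD opprB -lie_anti.
Qed.

Lemma elim_linearr p : linear (elim_bracket p).
Proof.
move=> k q r; congr (_, _); first by rewrite /= scaler0 addr0.
rewrite /= lieDr lieZr shift_linear !scalerDr scalerDl !scalerA opprD.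
rewrite scalerN !scalerA [p.1 * k]mulrC.
by rewrite !addrA (ACl (1*3*5*2*4*6)).
Qed.

Lemma elim_linearl q : linear (fun p => elim_bracket p q).
Proof.
by move=> k p r; rewrite !(elim_anti _ q) elim_linearr opprD scalerN.
Qed.

Lemma elim_jacobi p q r :
  elim_bracket p (elim_bracket q r) + elim_bracket q (elim_bracket r p)
  + elim_bracket r (elim_bracket p q) = 0.
Proof.
case: p q r => [a u] [b v] [c w]; congr (_, _); first by rewrite /= !addr0.
rewrite /= !scale0r !subr0.
have shE (k l : K) (x y z : divseq M) : shift (k *: x - l *: y + z) =
    k *: shift x - l *: shift y + shift z.
  by [].
have shL x y : shift (lie x y : divseq M) = lie (shift x) y + lie x (shift y) by [].
rewrite !shE !shL !lieDr !lieNr !lieZr !scalerDr !scalerN !scalerA.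
rewrite (mulrC c a) (mulrC b a) (mulrC c b).
rewrite (lie_anti w (shift v)) (lie_anti u (shift w)) (lie_anti v (shift u)).
rewrite !scalerN !addrA.
(* Opposite terms become neighbours; the last three, 7, 14 and 21, form the Jacobi sum in
   [divseq M]. *)
rewrite (ACl (1*9*15*2*8*16*3*19*4*13*10*5*18*6*11*20*17*12*7*14*21)).
by rewrite /= !(subrr, add0r) divlie_jacobi.
Qed.

HB.instance Definition _ := Lmodule_isLieAlgebra.Build K elim_lie
  elim_linearl elim_linearr elim_alternating elim_jacobi.

End DividedPowerSeries.

Lemma leaves_gt0 (X : Type) (t : Br X) : (0 < leaves t)%N.
Proof. by elim: t => //= l IHl r _; rewrite addn_gt0 IHl. Qed.

(** * Lazard elimination along a finite sequence of trees *)

Section Elimination.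
Variable X : Type.
Implicit Types (s : seq (Br X)) (g h l r t c : Br X).

Definition letter s g := if g is Node l _ then l \notin s else true.

(* A finite piece h1 < h2 < ... of a Hall set, to be eliminated from left to
   right.  When h is about to be eliminated it is a letter, as are the other
   trees whose left factor was eliminated; eliminating h replaces the letters
   c <> h by the letters (h, (h, ... (h, c))). *)
Inductive elim_seq : seq (Br X) -> Prop :=
| ElimNil : elim_seq [::]
| ElimCons h s of elim_seq s & h \notin s & letter (h :: s) h
    & (forall l r, Node l r \in s -> l \in h :: s -> r \in s)
    & (forall r, Node h r \in s -> letter s r) : elim_seq (h :: s).

(** Here [s] holds the trees still to be eliminated, and [g] is seen as a bracketing of the current
    letters: this is the word they form, and [elim_ev] is the value of the bracketing when they are
    sent to [f]. For [s] closed under subtrees the word of a tree of [s] is its ordinary foliage. *)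
Fixpoint elim_foliage s g : seq (Br X) :=
  match g with
  | Node l r => if l \in s then elim_foliage s l ++ elim_foliage s r else [:: g]
  | Leaf _ => [:: g]
  end.

Fixpoint elim_ev (K : fieldType) (M : lieAlgType K) (f : Br X -> M) s g : M :=
  match g with
  | Node l r => if l \in s then lie (elim_ev f s l) (elim_ev f s r) else f g
  | Leaf _ => f g
  end.

Lemma letter_foliage s g : letter s g -> elim_foliage s g = [:: g].
Proof. by case: g => [//|l r] /= /negPf ->. Qed.

Lemma letter_ev (K : fieldType) (M : lieAlgType K) (f : Br X -> M) s g :
  letter s g -> elim_ev f s g = f g.
Proof. by case: g => [//|l r] /= /negPf ->. Qed.

(* The letters of a word of [elim_foliage s] in terms of those of
   [elim_foliage (h :: s)]. *)
Fixpoint spell h c : seq (Br X) :=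
  if c is Node l r then if l == h then h :: spell h r else [:: c] else [:: c].

(** Reading from the right, each [h] is absorbed into the letter after it. A final [h] is dropped,
    so the word of [h] itself becomes empty, unlike that of any tree of [s]. *)
Definition unspell h : seq (Br X) -> seq (Br X) :=
  foldr (fun x w => if x == h then if w is c :: w' then Node h c :: w' else [::]
                    else x :: w) [::].

Lemma elim_foliage_sub h s g : elim_seq (h :: s) -> g \in s ->
  {subset elim_foliage s g <= s}.
Proof.
move=> hs; inversion hs as [|? ? _ _ _ hsub _]; subst.
elim: g => [x|l IHl r IHr] gs /=; first by move=> c; rewrite inE => /eqP ->.
case: ifP => ls c; last by rewrite inE => /eqP ->.
by rewrite mem_cat => /orP[/IHl|/IHr]; apply=> //; apply: (hsub l) gs _; rewrite inE ls orbT.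
Qed.

(** Both words split in the same way except at a node (h, r). Such a node is a single letter for
    [s], and so is [r] by the last clause of [elim_seq]; hence its word for [h :: s] is [h] followed
    by the spelling of [r]. *)
Lemma elim_foliage_spell h s g : elim_seq (h :: s) -> g \in s ->
  elim_foliage (h :: s) g = flatten (map (spell h) (elim_foliage s g)).
Proof.
move=> hs; inversion hs as [|? ? _ hNs hlh hsub hlet]; subst.
elim: g => [x|l IHl r IHr] gs //=; rewrite inE.
have [lh|lh] /= := eqVneq l h.
  rewrite lh (negPf hNs) /= eqxx cats0.
  rewrite IHr; last by apply: (hsub l) gs _; rewrite lh inE eqxx.
  rewrite lh in gs; rewrite (letter_foliage (hlet _ gs)) /= cats0.
  by rewrite (letter_foliage hlh).
case: ifP => ls; last by rewrite /= (negPf lh).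
by rewrite map_cat flatten_cat IHl ?IHr //; apply: (hsub l) gs _; rewrite inE ls orbT.
Qed.

Lemma unspell_spell h s c w : elim_seq (h :: s) -> c \in s ->
  unspell h (spell h c ++ w) = c :: unspell h w.
Proof.
move=> hs; inversion hs as [|? ? _ hNs _ hsub _]; subst.
have neqh d : d \in s -> d != h by apply: contraTneq => ->.
elim: c => [x|l _ r IHr] cs /=; first by rewrite (negPf (neqh _ cs)).
have [lh|lh] /= := eqVneq l h; last by rewrite (negPf (neqh _ cs)).
rewrite eqxx IHr ?lh //; apply: (hsub l) cs _.
by rewrite lh inE eqxx.
Qed.

Lemma unspell_foliage h s g : elim_seq (h :: s) -> g \in s ->
  unspell h (elim_foliage (h :: s) g) = elim_foliage s g.
Proof.
move=> hs gs; rewrite (elim_foliage_spell hs gs).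
have := elim_foliage_sub hs gs; elim: (elim_foliage s g) => [//|c w IHw] sub /=.
rewrite (unspell_spell _ hs) ?IHw // => [d dw|]; apply: sub; rewrite inE ?eqxx //.
by rewrite dw orbT.
Qed.

Lemma elim_foliage_neq0 s g : elim_foliage s g != [::].
Proof.
by elim: g => [//|l IHl r _] /=; case: ifP => // _; case: elim_foliage IHl.
Qed.

Lemma elim_foliage_inj s : elim_seq s -> {in s &, injective (elim_foliage s)}.
Proof.
elim: s => [//|h s IHs] hs; inversion hs as [|? ? hs' _ hh _ _]; subst.
have fh : unspell h (elim_foliage (h :: s) h) = [::].
  by rewrite letter_foliage //= eqxx.
have fg g : g \in s -> elim_foliage (h :: s) g <> elim_foliage (h :: s) h.
  move=> gs /(congr1 (unspell h)) /eqP.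
  by rewrite fh unspell_foliage // (negPf (elim_foliage_neq0 _ _)).
move=> g g'; rewrite !inE => /predU1P[->|gs] /predU1P[->|g's] //.
- by move=> /esym /fg; case.
- by move=> /fg; case.
- move=> /(congr1 (unspell h)); rewrite !unspell_foliage //; exact: IHs.
Qed.

(** In a relation over [h :: s], the d/dt component isolates the coefficient of [h], since the trees
    of [s] go to pure series. The constant terms of these series then give a relation over [s]. *)
Lemma elim_free (K : fieldType) s : elim_seq s -> forall L : lieAlgType K,
  exists (M : lieAlgType K) (f : Br X -> M), forall alpha : Br X -> K,
    \sum_(g <- s) alpha g *: elim_ev f s g = 0 -> {in s, forall g, alpha g = 0}.
Proof.
move=> hs L; elim: s / hs => [|h s hs [M [f IHf]] hNs hh hsub hlet].
  by exists L, (fun=> 0).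
pose f' c : elim_lie M :=
  if c == h then (1, 0) else (0, fun n => f (iter n (Node h) c)).
exists (elim_lie M), f'.
have f'h : elim_ev f' (h :: s) h = (1, 0) by rewrite letter_ev // /f' eqxx.
(* The constant term is enough for the conclusion, but bracketing with [h] shifts the series and so
   requires its next coefficients. They are recorded for letters only, because [r] is a letter
   whenever (h, r) occurs in [s]. *)
have evE g : g \in s -> exists u : divseq M, [/\ elim_ev f' (h :: s) g = (0, u),
    u 0%N = elim_ev f s g &
    letter s g -> u = (fun n => f (iter n (Node h) g)) ].
  have f'E c : c \in s -> f' c = (0, fun n => f (iter n (Node h) c)).
    by move=> cs; rewrite /f'; case: eqVneq => // ch; rewrite -ch cs in hNs.
  elim: g => [x|l IHl r IHr] gs.
    by exists (fun n => f (iter n (Node h) (Leaf x))); rewrite /= f'E.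
  have [lhs|lNhs] := boolP (l \in h :: s); last first.
    exists (fun n => f (iter n (Node h) (Node l r))).
    rewrite letter_ev // letter_ev ?f'E //=.
    by move: lNhs; rewrite inE negb_or => /andP[].
  have [v [vE v0 vlet]] := IHr (hsub _ _ gs lhs).
  rewrite [elim_ev _ (h :: s) _]/= lhs vE; have [lh|lNh] := eqVneq l h.
    rewrite lh f'h in gs lhs *; exists (shift v); split.
    - by rewrite /lie /= /elim_bracket /= scale1r scale0r subr0 lie0l addr0.
    - by rewrite letter_ev //= (vlet (hlet _ gs)).
    - by move=> _; rewrite (vlet (hlet _ gs)); apply/funext => n; rewrite /shift iterSr.
  have ls : l \in s by move: lhs; rewrite inE (negPf lNh).
  have [u [uE u0 _]] := IHl ls; rewrite uE; exists (lie u v); split.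
  - by rewrite {1}/lie /= /elim_bracket /= !scale0r subr0 add0r.
  - by rewrite /= ls -u0 -v0.
  - by rewrite /= ls.
move=> alpha; rewrite big_cons f'h => sum0.
have ev2 g : g \in s -> (elim_ev f' (h :: s) g).1 = 0 /\
    (elim_ev f' (h :: s) g).2 0%N = elim_ev f s g.
  by move=> /evE[u [-> <- _]].
pose fst_sum (p : elim_lie M) := p.1; pose snd0 (p : elim_lie M) : M := p.2 0%N.
have ah : alpha h = 0.
  have := congr1 fst_sum sum0.
  rewrite /fst_sum /= raddf_sum big_seq big1 /= ?addr0 => [|g gs].
    by rewrite /GRing.scale /= mulr1.
  by rewrite /= (ev2 g gs).1 scaler0.
move=> g; rewrite inE => /predU1P[->//|]; apply: IHf g.
have := congr1 snd0 sum0; rewrite ah scale0r add0r => sum1.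
rewrite -[RHS]/(snd0 0) -sum1.
have snd0D : {morph snd0 : p q / p + q} by [].
rewrite (big_morph snd0 snd0D (erefl : snd0 0 = 0)) !big_seq; apply: eq_bigr => g gs.
by rewrite -(ev2 g gs).2.
Qed.

End Elimination.

(** * Foliage and subtrees *)

Section Foliage.
Variable X : Type.
Implicit Types t g : Br X.

Fixpoint foliage t : seq (Br X) :=
  if t is Node l r then foliage l ++ foliage r else [:: t].

Fixpoint subtrees t : seq (Br X) :=
  t :: (if t is Node l r then subtrees l ++ subtrees r else [::]).

Lemma size_foliage t : size (foliage t) = leaves t.
Proof. by elim: t => //= l <- r <-; rewrite size_cat. Qed.

Lemma mem_subtrees t : t \in subtrees t.
Proof. by case: t => [x|l r]; rewrite inE eqxx. Qed.

Lemma subtrees_node t l r : Node l r \in subtrees t ->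
  l \in subtrees t /\ r \in subtrees t.
Proof.
elim: t => [x|l' IHl r' IHr] /=; first by rewrite inE => /eqP.
rewrite !inE !mem_cat => /predU1P[[-> ->]|/orP[/IHl|/IHr] [-> ->]].
- by rewrite !mem_subtrees !orbT.
- by rewrite !(orTb, orbT).
- by rewrite !orbT.
Qed.

End Foliage.

(** * Hall sets as elimination sequences *)

Section HallOrder.
Variables (X : Type) (B : set (Br X)) (le : rel (Br X)).
Hypothesis hB : is_hall_set B le.
Implicit Types a b c l r t g : Br X.

Definition lt a b := (a != b) && le a b.

Lemma hall_le_lt_trans a b c : a \in B -> b \in B -> c \in B ->
  le a b -> lt b c -> lt a c.
Proof.
move=> aB bB cB ab /andP[bc lbc]; rewrite /lt (hall_le_trans hB bB aB cB ab lbc) andbT.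
apply: contraNneq bc => ac; apply/eqP; apply: (hall_le_anti hB) => //.
by rewrite lbc -ac.
Qed.

Lemma hall_lt_le_trans a b c : a \in B -> b \in B -> c \in B ->
  lt a b -> le b c -> lt a c.
Proof.
move=> aB bB cB /andP[ab lab] bc; rewrite /lt (hall_le_trans hB bB aB cB lab bc) andbT.
apply: contraNneq ab => ac; apply/eqP; apply: (hall_le_anti hB) => //.
by rewrite lab ac.
Qed.

Lemma hall_le_lt_false a b : a \in B -> b \in B -> le a b -> lt b a -> False.
Proof. by move=> aB bB ab /(hall_le_lt_trans aB bB aB ab); rewrite /lt eqxx. Qed.

Lemma hall_le_refl a : a \in B -> le a a.
Proof. by move=> aB; have := hall_le_total hB aB aB; rewrite orbb. Qed.

Lemma hall_total a b : a \in B -> b \in B -> [\/ a = b, lt a b | lt b a].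
Proof.
move=> aB bB; rewrite /lt (eq_sym b); have [->|ab] := eqVneq a b; first by constructor 1.
by have /orP[h|h] := hall_le_total hB aB bB; rewrite h; [constructor 2|constructor 3].
Qed.

Lemma hall_nodeP l r : Node l r \in B -> [/\ l \in B, r \in B, lt l r,
  lt l (Node l r) & forall l' r', r = Node l' r' -> le l' l].
Proof.
move=> lrB; have [lB rB lr hr] := (hall_node hB l r).1 lrB; split=> //.
- by apply/andP.
- by apply/andP; apply: (hall_lt_node hB).
- by move=> l' r' er; rewrite er in hr.
Qed.

Lemma hall_subtrees t : t \in B -> {subset subtrees t <= B}.
Proof.
elim: t => [x|l IHl r IHr] tB g /=; first by rewrite mem_seq1 => /eqP ->.
have [lB rB _ _ _] := hall_nodeP tB.
by rewrite in_cons mem_cat => /predU1P[->//|/orP[/IHl|/IHr]]; apply.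
Qed.

(** A left factor is smaller than its tree, so the minimum [h] is a letter; and [h] cannot be the
    right factor of a tree (l, h), since l < h. If (h, (l', r')) occurs, the Hall condition gives l'
    <= h, so l' is not among the later trees. *)
Lemma hall_sorted_elim_seq (s : seq (Br X)) :
  {subset s <= B} -> uniq s -> pairwise le s ->
  (forall l r, Node l r \in s -> l \in s -> r \in s) -> elim_seq s.
Proof.
elim: s => [|h s IHs] sB; first by constructor.
rewrite cons_uniq pairwise_cons => /andP[hNs us] /andP[/allP hs ss] hsub.
have hB' : h \in B by apply: sB; rewrite inE eqxx.
have sB' : {subset s <= B} by move=> g gs; apply: sB; rewrite inE gs orbT.
have hle g : g \in h :: s -> le h g.
  by rewrite inE => /predU1P[->|/hs//]; apply: hall_le_refl.
have hsub' l r : Node l r \in s -> l \in h :: s -> r \in s.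
  move=> lrs lhs; have := hsub l r; rewrite !inE lrs orbT => /(_ isT lhs) /predU1P[rh|//].
  have [lB _ lr _ _] := hall_nodeP (sB' _ lrs).
  by case: (hall_le_lt_false hB' lB (hle _ lhs)); rewrite -rh.
constructor=> //.
- by apply: IHs => // l r lrs ls; apply: (hsub' l) => //; rewrite inE ls orbT.
- case: h hB' hle {hs hsub hsub' sB hNs} => [//|l r] lrB hle /=.
  have [lB _ _ ll _] := hall_nodeP lrB.
  by apply/negP => /hle h; case: (hall_le_lt_false lrB lB h).
- case=> [//|l' r'] hrs /=; have [_ rB _ _ /(_ _ _ erefl) l'h] := hall_nodeP (sB' _ hrs).
  apply/negP => l's; have := hs _ l's; have [l'B _ _ _ _] := hall_nodeP rB => hl'.
  by case/negP: hNs; rewrite (hall_le_anti hB hB' l'B) // hl' l'h.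
Qed.

Lemma hall_elim_seq (T : seq (Br X)) : {subset T <= B} -> exists s,
  [/\ elim_seq s, uniq s, {subset s <= B}, {subset T <= s} &
      forall l r, Node l r \in s -> l \in s /\ r \in s].
Proof.
move=> TB; pose s := sort le (undup (flatten (map (@subtrees X) T))).
have memE g : (g \in s) = has (fun t => g \in subtrees t) T.
  by rewrite mem_sort mem_undup; apply/flatten_mapP/hasP => -[t tT gt]; exists t.
have sB : {subset s <= B}.
  by move=> g; rewrite memE => /hasP[t /TB tB]; apply: hall_subtrees.
have su : uniq s by rewrite sort_uniq undup_uniq.
have hsub l r : Node l r \in s -> l \in s /\ r \in s.
  rewrite !memE => /hasP[t tT /subtrees_node[lt rt]].
  by split; apply/hasP; exists t.
exists s; split=> //; last first.
  by move=> t tT; rewrite memE; apply/hasP; exists t; rewrite ?mem_subtrees.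
apply: hall_sorted_elim_seq => //; last by move=> l r /hsub[].
pose P := [pred x | x \in B].
have sB' : all P s by apply/allP.
rewrite -(sorted_pairwise_in (P := P)) //; last first.
  by move=> x y z xB yB zB; apply: (hall_le_trans hB).
apply: (sort_sorted_in (P := P)); last by apply/allP => g gs; apply: sB; rewrite mem_sort.
by move=> x y xB yB; apply: (hall_le_total hB).
Qed.

Lemma hall_foliage_inj : {in B &, injective (@foliage X)}.
Proof.
move=> t t' tB t'B tt'.
have [|s [hs _ sB Ts hsub]] := @hall_elim_seq [:: t; t'].
  by move=> g; rewrite !(in_cons, in_nil) orbF => /orP[]/eqP->.
have folE g : g \in s -> elim_foliage s g = foliage g.
  elim: g => [//|l IHl r IHr] lrs /=; have [ls rs] := hsub _ _ lrs.
  by rewrite ls IHl ?IHr.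
have [ts t's] : t \in s /\ t' \in s by rewrite !Ts ?inE ?eqxx ?orbT.
by apply: (elim_foliage_inj hs); rewrite ?folE.
Qed.

(** * Linear independence of Hall trees in the free Lie algebra *)

Section Free.
Variables (K : fieldType) (L : lieAlgType K) (iota : X -> L).
Hypothesis hL : is_free_lie iota.

(** The universal property carries a relation in [L] to the algebra of [elim_free]: over a sequence
    closed under subtrees, [elim_ev] unfolds down to the leaves, as [ev] does. *)
Lemma hall_ev_free (s : seq (Br X)) (alpha : Br X -> K) : uniq s -> {subset s <= B} ->
  \sum_(g <- s) alpha g *: ev iota g = 0 -> {in s, forall g, alpha g = 0}.
Proof.
move=> us sB sum0; have [s' [hs' us' _ ss' hsub]] := hall_elim_seq sB.
have [M [f fP]] := elim_free hs' L.
have [phi [[[phil phim] phix] _]] := hL (fun x => f (Leaf x)).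
have evE g : g \in s' -> phi (ev iota g) = elim_ev f s' g.
  elim: g => [x|l IHl r IHr] lrs /=; first exact: phix.
  by have [ls rs] := hsub _ _ lrs; rewrite ls phim IHl ?IHr.
have phiD : {morph phi : u v / u + v}.
  by move=> u v; have := phil 1 u v; rewrite !scale1r.
have phi0 : phi 0 = 0 by apply: (addrI (phi 0)); rewrite -phiD !addr0.
have phiZ k u : phi (k *: u) = k *: phi u.
  by have := phil k u 0; rewrite phi0 !addr0.
(* The relation over [s] is extended by zero coefficients to the closed sequence [s']. *)
pose beta g := if g \in s then alpha g else 0.
suff h : {in s', forall g, beta g = 0}.
  by move=> g gs; have := h _ (ss' _ gs); rewrite /beta gs.
apply: fP; move: (congr1 phi sum0); rewrite phi0 (big_morph phi phiD phi0) => sum1.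
rewrite -[RHS]sum1.
transitivity (\sum_(g <- s' | g \in s) alpha g *: elim_ev f s' g).
  rewrite [RHS]big_mkcond; apply: eq_bigr => g _.
  by rewrite /beta; case: ifP; rewrite ?scale0r.
rewrite -[LHS]big_filter.
rewrite [LHS](perm_big s) /=; last first.
  apply: uniq_perm; rewrite ?filter_uniq //.
  move=> g; rewrite mem_filter andb_idr //; exact: ss'.
by rewrite !big_seq; apply: eq_bigr => g gs; rewrite phiZ evE ?ss'.
Qed.

End Free.
End HallOrder.

(** * Combinations of trees and the Hall norm *)

Lemma sum_by_snd (V : nmodType) (A I : eqType) (s : seq (A * I)) (t : seq I)
    (G : A * I -> V) :
  uniq t -> {subset map snd s <= t} ->
  \sum_(p <- s) G p = \sum_(c <- t) \sum_(p <- s | p.2 == c) G p.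
Proof.
move=> ut st; rewrite (exchange_big_dep predT) //= !big_seq; apply: eq_bigr => p ps.
rewrite -big_filter (eq_filter (a2 := pred1 p.2)) => [|c]; last by rewrite /= eq_sym.
by rewrite filter_pred1_uniq ?big_seq1 // st // map_f.
Qed.

Section HallCombinations.
Variables (K : numFieldType) (X : Type) (L : lieAlgType K) (iota : X -> L).
Implicit Types (u v : L) (N : K) (Q : Br X -> Prop) (c : Br X).

(** Trees may be repeated in the list, so sums are concatenations; collecting equal trees can only
    lower the sum of absolute values. *)
Definition tree_comb Q N u := exists s : seq (K * Br X),
  [/\ forall p, p \in s -> Q p.2, \sum_(p <- s) `|p.1| <= N &
      u = \sum_(p <- s) p.1 *: ev iota p.2].

Lemma tree_comb_sub Q Q' N N' u : (forall c, Q c -> Q' c) -> N <= N' ->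
  tree_comb Q N u -> tree_comb Q' N' u.
Proof.
move=> QQ' NN' [s [sQ sN ->]]; exists s; split=> //; last exact: le_trans NN'.
by move=> p /sQ /QQ'.
Qed.

Lemma tree_comb0 Q : tree_comb Q 0 0.
Proof. by exists [::]; split; rewrite ?big_nil. Qed.

Lemma tree_comb_ev Q c : Q c -> tree_comb Q 1 (ev iota c).
Proof.
move=> Qc; exists [:: (1, c)]; split; rewrite ?big_seq1 ?normr1 ?scale1r //.
by move=> p; rewrite mem_seq1 => /eqP ->.
Qed.

Lemma tree_combD Q N N' u v :
  tree_comb Q N u -> tree_comb Q N' v -> tree_comb Q (N + N') (u + v).
Proof.
move=> [s [sQ sN ->]] [s' [sQ' sN' ->]]; exists (s ++ s').
split; rewrite ?big_cat ?lerD //.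
by move=> p; rewrite mem_cat => /orP[/sQ|/sQ'].
Qed.

Lemma tree_combZ Q N u k : tree_comb Q N u -> tree_comb Q (`|k| * N) (k *: u).
Proof.
move=> [s [sQ sN ->]]; exists [seq (k * p.1, p.2) | p <- s]; split.
- by move=> _ /mapP[p /sQ Qp ->].
- rewrite big_map (eq_bigr (fun p => `|k| * `|p.1|)) => [|p _]; last by rewrite /= normrM.
  by rewrite -mulr_sumr ler_wpM2l.
- by rewrite big_map scaler_sumr; apply: eq_bigr => p _; rewrite scalerA.
Qed.

Lemma tree_combN Q N u : tree_comb Q N u -> tree_comb Q N (- u).
Proof. by move=> /(tree_combZ (-1)); rewrite normrN1 mul1r scaleN1r. Qed.

Lemma tree_comb_bind (f : L -> L) Q Q' N N' u : linear f -> 0 <= N' ->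
  (forall c, Q c -> tree_comb Q' N' (f (ev iota c))) ->
  tree_comb Q N u -> tree_comb Q' (N * N') (f u).
Proof.
move=> flin N'0 fQ [s [sQ sN ->]].
have f0 : f 0 = 0.
  by apply: (addrI (f 0)); have := flin 1 0 0; rewrite !scale1r !addr0 => <-.
apply: (@tree_comb_sub Q' _ ((\sum_(p <- s) `|p.1|) * N')) => //.
  exact: ler_wpM2r.
elim: s sQ {sN} => [|p s IHs] sQ; first by rewrite !big_nil mul0r f0; apply: tree_comb0.
rewrite !big_cons mulrDl flin; apply: tree_combD.
  by apply/tree_combZ/fQ/sQ; rewrite in_cons eqxx.
by apply: IHs => q qs; apply: sQ; rewrite in_cons qs orbT.
Qed.

Section Norm.
Variables (B : set (Br X)) (le : rel (Br X)).
Hypotheses (hB : is_hall_set B le) (hL : is_free_lie iota).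

Lemma hall_decomp_unique u (alpha beta : {fsfun Br X -> K with 0}) :
  is_hall_decomp iota B u alpha -> is_hall_decomp iota B u beta -> alpha = beta.
Proof.
move=> [sa ua] [sb ub]; pose s := (finsupp alpha `|` finsupp beta)%fset.
have sE (gamma : {fsfun Br X -> K with 0}) : (finsupp gamma `<=` s)%fset ->
  \sum_(c <- finsupp gamma) gamma c *: ev iota c = \sum_(c <- s) gamma c *: ev iota c.
  by move=> sub; apply: big_fset_incl sub _ => c _ /fsfun_dflt ->; rewrite scale0r.
have sB : {subset s <= B}.
  by move=> c; rewrite in_fsetU => /orP[/sa|/sb].
have diff0 : \sum_(c <- s) (alpha c - beta c) *: ev iota c = 0.
  under eq_bigr do rewrite scalerBl.
  by rewrite sumrB -!sE ?fsubsetUl ?fsubsetUr // -ua -ub subrr.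
apply/fsfunP => c; have [cs|] := boolP (c \in s).
  by apply/eqP; rewrite -subr_eq0 (hall_ev_free hB hL _ _ diff0) ?fset_uniq.
rewrite in_fsetU negb_or => /andP[ca cb].
by rewrite !fsfun_dflt.
Qed.

Lemma hall_norm_le N u : tree_comb (fun c => c \in B) N u -> hall_norm iota B u <= N.
Proof.
move=> [s [sB sN uE]].
pose t := [fset c in map snd s]%fset.
pose alpha : {fsfun Br X -> K with 0} :=
  [fsfun c in t => \sum_(p <- s | p.2 == c) p.1].
have st : {subset map snd s <= t} by move=> c; rewrite in_fset.
have sub : (finsupp alpha `<=` t)%fset by apply: finsupp_sub.
have alphaE c : c \in t -> alpha c = \sum_(p <- s | p.2 == c) p.1.
  by move=> ct; rewrite fsfunE ct.
have hdec : is_hall_decomp iota B u alpha.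
  split=> [c /(fsubsetP sub)|].
    by rewrite in_fset => /mapP[p ps ->]; apply: sB.
  rewrite (big_fset_incl _ sub) => [|c _ /fsfun_dflt ->]; last by rewrite scale0r.
  rewrite uE (sum_by_snd (t := t)) ?fset_uniq // !big_seq; apply: eq_bigr => c ct.
  by rewrite alphaE // scaler_suml; apply: eq_bigr => p /eqP ->.
(* [hdec] shows that [xget] returns a genuine decomposition, and uniqueness identifies it with
   [alpha]. *)
have -> : hall_norm iota B u = \sum_(c <- finsupp alpha) `|alpha c|.
  rewrite /hall_norm (_ : hall_coord iota B u = alpha) //.
  by apply: (hall_decomp_unique _ hdec); apply: (xgetI _ hdec).
apply: le_trans sN; rewrite (big_fset_incl _ sub); last first.
  by move=> c _ /fsfun_dflt ->; rewrite normr0.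
rewrite (sum_by_snd (t := t)) ?fset_uniq // !big_seq; apply: ler_sum => c ct.
by rewrite alphaE // ler_norm_sum.
Qed.

End Norm.
End HallCombinations.

(** * Counting words, and arithmetic of the exponent *)

Fixpoint words_upto (T : eqType) (A : seq T) k : seq (seq T) :=
  [::] :: (if k is k'.+1 then [seq x :: w | x <- A, w <- words_upto A k'] else [::]).

Lemma mem_words_upto (T : eqType) (A : seq T) k w :
  (size w <= k)%N -> {subset w <= A} -> w \in words_upto A k.
Proof.
elim: k w => [|k IHk] [|x w] //= wk wA; rewrite in_cons /=.
apply: allpairs_f; first by apply: wA; rewrite in_cons eqxx.
by apply: IHk => // y yw; apply: wA; rewrite in_cons yw orbT.
Qed.

(** The strict bound carries the induction: if x words have length at most k, then 2 + n x <= n (x +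
    1). *)
Lemma size_words_upto (T : eqType) (A : seq T) k n :
  (1 < n)%N -> (size A <= n)%N -> (size (words_upto A k) < n ^ k.+1)%N.
Proof.
move=> n1 An; elim: k => [|k IHk]; first by rewrite expn1.
rewrite /= size_allpairs expnS; apply: leq_trans (leq_mul (leqnn n) IHk).
by rewrite mulnS -[leqLHS]/(2 + _ * _)%N leq_add // leq_mul.
Qed.

(* With 2^e(n) the bound of the theorem: n^n (1 + e(n-1)) <= e(n). *)
Lemma exponent_step n : (1 < n)%N ->
  (n ^ n * (1 + n.-1 ^ ((n.-1 * n.-1.+1) %/ 2)) <= n ^ ((n * n.+1) %/ 2))%N.
Proof.
case: n => [//|n] n1 /=.
(* Triangular numbers differ by n+1, which cancels the factor (n+1)^(n+1). What remains is 1 + n^k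
   <= (n+1)^k with k > 0. *)
have -> : ((n.+1 * n.+2) %/ 2 = n.+1 + (n * n.+1) %/ 2)%N.
  rewrite -divnMDl //; congr (_ %/ 2)%N.
  by rewrite [(n * _)%N]mulnC -mulnDr add2n.
rewrite expnD leq_mul2l; apply/orP; right.
rewrite add1n ltn_exp2r // divn_gt0 //.
by case: n n1 => // n _; rewrite leq_mul.
Qed.

Lemma exponent_mono m n : (0 < m)%N -> (m <= n)%N ->
  (m ^ ((m * m.+1) %/ 2) <= n ^ ((n * n.+1) %/ 2))%N.
Proof.
move=> m0 mn; apply: (@leq_trans (n ^ ((m * m.+1) %/ 2))).
  by case: (_ %/ 2)%N => // k; rewrite leq_exp2r.
by rewrite leq_pexp2l ?(leq_trans m0) // leq_div2r // leq_mul.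
Qed.

(** * Expansion of a bracket of two Hall trees *)

Section Rewriting.
Variables (K : numFieldType) (X : Type) (L : lieAlgType K) (iota : X -> L).
Variables (B : set (Br X)) (le : rel (Br X)).
Hypothesis hB : is_hall_set B le.
Implicit Types (a b c t : Br X) (A : seq (Br X)).

(** The foliage embeds [T] into the words of length at most n-1 over [A], and there are fewer than
    n^n of these. *)
Lemma hall_count n A (T : seq (Br X)) : (1 < n)%N -> (size A <= n)%N -> uniq T ->
  (forall t, t \in T -> [/\ t \in B, (leaves t < n)%N & {subset foliage t <= A}]) ->
  (size T <= n ^ n)%N.
Proof.
move=> n1 An Tu hT; apply: (@leq_trans (size (words_upto A n.-1))); last first.
  by apply: ltnW; have := size_words_upto n.-1 n1 An; rewrite prednK // ltnW.
rewrite -(size_map (@foliage X)); apply: uniq_leq_size.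
  rewrite map_inj_in_uniq // => t t' /hT[tB _ _] /hT[t'B _ _].
  exact: (hall_foliage_inj hB).
move=> _ /mapP[t /hT[tB tn tA] ->]; apply: mem_words_upto => //.
by rewrite size_foliage -ltnS prednK // ltnW.
Qed.

(** The trees allowed in the expansion of a bracket [a, b] of degree [n]. The bound on the left
    factor puts them strictly above [a], so that bracketing them with the factors of [b] gives
    brackets with both arguments above [a]. *)
Definition hall_above a n A c := [/\ c \in B,
  exists l r, c = Node l r /\ le a l, leaves c = n & {subset foliage c <= A}].

Lemma hall_above_lt a n A c : a \in B -> hall_above a n A c -> lt le a c.
Proof.
move=> aB [cB [l [r [cE al]]] _ _]; rewrite cE in cB *.
have [lB _ _ ll _] := hall_nodeP hB cB.
exact: (hall_le_lt_trans hB aB lB cB al ll).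
Qed.

Lemma hall_above_le a a' n A c : a \in B -> a' \in B -> le a a' ->
  hall_above a' n A c -> hall_above a n A c.
Proof.
move=> aB a'B aa' [cB [l [r [cE a'l]]] cn cA]; split=> //; exists l, r; split=> //.
rewrite cE in cB; have [lB _ _ _ _] := hall_nodeP hB cB.
exact: (hall_le_trans hB a'B aB lB).
Qed.

(** If [b] were a leaf, or had left factor at most [a], the Hall condition would put (a, b) in
    [B]. *)
Lemma hall_split a b : a \in B -> b \in B -> lt le a b -> Node a b \notin B ->
  exists b1 b2, b = Node b1 b2 /\ lt le a b1.
Proof.
move=> aB bB /andP[ab lab] /negP abNB; case: b => [x|b1 b2] in bB ab lab abNB *.
  by case: abNB; apply/(hall_node hB).
exists b1, b2; split=> //; have [b1B _ _ _ _] := hall_nodeP hB bB.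
have [ab1|//|b1a] := hall_total hB aB b1B; case: abNB; apply/(hall_node hB); split=> //.
- by rewrite ab1; apply: (hall_le_refl hB).
- by case/andP: b1a.
Qed.

(** Induction on [r], which bounds the number of Hall trees above [a] that could replace it as
    smaller argument. A split yields two inner brackets of norm at most [F], hence the factor 2F. *)
Lemma lie_tree_comb_step n A F :
  (forall a b, a \in B -> b \in B -> lt le a b -> (leaves a + leaves b < n)%N ->
    {subset foliage a ++ foliage b <= A} ->
    tree_comb iota (hall_above a (leaves a + leaves b) A) F
      (lie (ev iota a) (ev iota b))) ->
  1 <= F -> forall r a b, a \in B -> b \in B -> lt le a b ->
  (leaves a + leaves b = n)%N -> {subset foliage a ++ foliage b <= A} ->
  (forall T : seq (Br X), uniq T -> (forall t, t \in T -> [/\ t \in B,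
     (leaves t < n)%N, {subset foliage t <= A} & lt le a t]) -> (size T <= r)%N) ->
  tree_comb iota (hall_above a n A) ((2 * F) ^+ r) (lie (ev iota a) (ev iota b)).
Proof.
move=> IH F1; have F0 : 0 <= F by apply: le_trans F1.
have F2 : 1 <= 2 * F.
  by apply: le_trans F1 _; rewrite ler_peMl // ler1n.
have hall_case r a b : Node a b \in B -> (leaves a + leaves b = n)%N ->
    {subset foliage a ++ foliage b <= A} ->
    tree_comb iota (hall_above a n A) ((2 * F) ^+ r) (lie (ev iota a) (ev iota b)).
  move=> abB abn abA; have [aB _ _ _ _] := hall_nodeP hB abB.
  apply: (tree_comb_sub (Q := hall_above a n A) _ (exprn_ege1 r F2)) => //.
  apply: (tree_comb_ev iota (c := Node a b)); split=> //.
  by exists a, b; split=> //; apply: (hall_le_refl hB).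
elim/ltn_ind => r IHr a b aB bB ab abn abA hT.
have [abB|abNB] := boolP (Node a b \in B); first exact: hall_case.
have [b1 [b2 [bE ab1]]] := hall_split aB bB ab abNB; subst b.
have [b1B b2B b12 _ _] := hall_nodeP hB bB.
have ab2 : lt le a b2 := hall_lt_le_trans hB aB b1B b2B ab1 (proj2 (andP b12)).
have {}abA t : [|| t \in foliage a, t \in foliage b1 | t \in foliage b2] -> t \in A.
  by move=> ht; apply: abA; rewrite /= !mem_cat.
have := leaves_gt0 a; have := leaves_gt0 b1; have := leaves_gt0 b2.
move: abn => /= abn b2_gt0 b1_gt0 a_gt0.
(* The tree [b1] is itself one of the trees counted by [r]. *)
have r_gt0 : (0 < r)%N.
  apply: (hT [:: b1]) => // t; rewrite mem_seq1 => /eqP ->; split=> //; last first.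
    by move=> x xb; apply: abA; rewrite xb orbT.
  by rewrite -abn addnCA -{1}[leaves b1]addn0 ltn_add2l addn_gt0 a_gt0.
case: r r_gt0 IHr hT => [//|r] _ IHr hT.
have above c c' : c \in B -> c' \in B -> lt le a c -> lt le a c' ->
    (leaves c + leaves c' = n)%N -> {subset foliage c ++ foliage c' <= A} ->
    lt le c c' -> tree_comb iota (hall_above a n A) ((2 * F) ^+ r)
      (lie (ev iota c) (ev iota c')).
  move=> cB c'B ac ac' ccn ccA cc; apply: (tree_comb_sub (Q := hall_above c n A)).
  - by move=> d; apply: hall_above_le => //; case/andP: ac.
  - exact: lexx.
  (* The tree [c] is above [a] but not above itself, so at least one tree fewer lies above [c]. *)
  apply: IHr => // T Tu Th; apply: (hT (c :: T)).
    rewrite cons_uniq Tu andbT; apply/negP => /Th[_ _ _].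
    by rewrite /lt eqxx.
  move=> t; rewrite in_cons => /predU1P[->|/Th[tB tn tA ct]]; last first.
    split=> //; apply: (hall_lt_le_trans hB aB cB tB ac); by case/andP: ct.
  split=> //; last by move=> x xc; apply: ccA; rewrite mem_cat xc.
  by rewrite -ccn -{1}[leaves c]addn0 ltn_add2l leaves_gt0.
(* Antisymmetry of the bracket removes the assumption c < c'. *)
have {}above c c' : c \in B -> c' \in B -> lt le a c -> lt le a c' ->
    (leaves c + leaves c' = n)%N -> {subset foliage c ++ foliage c' <= A} ->
    tree_comb iota (hall_above a n A) ((2 * F) ^+ r) (lie (ev iota c) (ev iota c')).
  move=> cB c'B ac ac' ccn ccA; have [->|cc|cc] := hall_total hB cB c'B.
  - rewrite lie_alternating; apply: tree_comb_sub (tree_comb0 iota (hall_above a n A)) => //.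
    by apply: exprn_ge0; apply: le_trans F2.
  - exact: above.
  - rewrite lie_anti; apply: tree_combN; apply: above => //; first by rewrite addnC.
    by move=> x; rewrite mem_cat orbC -mem_cat; apply: ccA.
have subA1 : {subset foliage a ++ foliage b1 <= A}.
  by move=> x; rewrite mem_cat => /orP[] xt; apply: abA; rewrite xt ?orbT.
have subA2 : {subset foliage a ++ foliage b2 <= A}.
  by move=> x; rewrite mem_cat => /orP[] xt; apply: abA; rewrite xt ?orbT.
have comb_ab1 : tree_comb iota (hall_above a (leaves a + leaves b1) A) F
    (lie (ev iota a) (ev iota b1)).
  by apply: IH => //; rewrite -abn ltn_add2l -{1}[leaves b1]addn0 ltn_add2l.
have comb_ab2 : tree_comb iota (hall_above a (leaves a + leaves b2) A) F
    (lie (ev iota a) (ev iota b2)).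
  by apply: IH => //; rewrite -abn ltn_add2l -{1}[leaves b2]add0n ltn_add2r.
have F2r : 0 <= (2 * F) ^+ r by apply/exprn_ge0/(le_trans _ F2).
(* The bound (2F)^(r+1) is two copies of F (2F)^r, one for each Leibniz term: [F] for the inner
   bracket, (2F)^r for each outer bracket it produces. *)
rewrite /= lie_leibniz exprS -mulrA mulr_natl mulr2n; apply: tree_combD.
  apply: (tree_comb_bind (lie_linearl (ev iota b2)) F2r _ comb_ab1) => c hc.
  have [cB _ cn cA] := hc; apply: above => //; first exact: hall_above_lt hc.
    by rewrite cn -abn addnA.
  move=> x; rewrite mem_cat => /orP[/cA//|xb]; apply: abA; by rewrite xb !orbT.
apply: (tree_comb_bind (lie_linearr (ev iota b1)) F2r _ comb_ab2) => c hc.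
have [cB _ cn cA] := hc; apply: above => //; first exact: hall_above_lt hc.
  by rewrite cn -abn addnCA.
move=> x; rewrite mem_cat => /orP[xb|/cA//]; apply: abA; by rewrite xb !orbT.
Qed.

Lemma lie_tree_comb n a b : a \in B -> b \in B -> lt le a b ->
  (leaves a + leaves b = n)%N ->
  tree_comb iota (hall_above a n (foliage a ++ foliage b))
    (2 ^+ (n ^ ((n * n.+1) %/ 2))%N) (lie (ev iota a) (ev iota b)).
Proof.
elim/ltn_ind: n a b => n IHn a b aB bB ab abn.
have n1 : (1 < n)%N by rewrite -abn -[2%N]/(1 + 1)%N leq_add ?leaves_gt0.
set A := foliage a ++ foliage b.
have An : (size A <= n)%N by rewrite size_cat !size_foliage abn.
(* The bound in degree n-1 serves for all smaller degrees by [exponent_mono]. *)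
pose F : K := 2 ^+ (n.-1 ^ ((n.-1 * n.-1.+1) %/ 2))%N.
have F1 : 1 <= F by rewrite exprn_ege1 // ler1n.
(* The number of steps is n^n by [hall_count], and 2F is 2 to the power 1 + e(n-1), so
   [exponent_step] applies. *)
apply: (@tree_comb_sub _ _ _ _ (hall_above a n A) _ ((2 * F) ^+ (n ^ n))) => //.
  by rewrite /F -exprS -exprM mulnC ler_eXn2l ?ltr1n // exponent_step.
apply: (lie_tree_comb_step _ F1) => //.
- move=> c d cB dB cd cdn cdA; have := IHn _ cdn c d cB dB cd erefl.
  apply: tree_comb_sub => [g [gB gN gn gA]|]; first by split=> // x /gA /cdA.
  rewrite ler_eXn2l ?ltr1n // exponent_mono ?addn_gt0 ?leaves_gt0 //.
  by rewrite -ltnS prednK // ltnW.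
- move=> T Tu hT; apply: (hall_count n1 An) => // t /hT[tB tn tA _]; split=> //.
Qed.

End Rewriting.

Theorem theorem1p1 (K : numFieldType) (hK : real_or_complex K)
    (X : Type) (hX : exists x y : X, x <> y)
    (L : lieAlgType K) (iota : X -> L) (hL : is_free_lie iota)
    (B : set (Br X)) (le : rel (Br X)) (hB : is_hall_set B le)
    (a b : Br X) (ha : a \in B) (hb : b \in B)
    (hab : a != b /\ le a b) (n : nat) (hn : n = (leaves a + leaves b)%N) :
  hall_norm iota B (lie (ev iota a) (ev iota b))
    <= 2 ^+ (n ^ ((n * n.+1) %/ 2))%N.
Proof.
apply: (hall_norm_le hB hL).
have ab : lt le a b by apply/andP.
by apply: tree_comb_sub (lie_tree_comb iota hB ha hb ab (esym hn)) => // c [].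
Qed.
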